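(* Let $\sigma,b:\mathbb{R}\to\mathbb{R}$ be smooth functions with bounded derivatives. Define operators $A^*$ and $L^*$ by $$A^*\phi=-\partial(\sigma\phi),\qquad L^*\phi=\tfrac12\,\partial^2(\sigma^2\phi)-\partial(b\phi).$$ Then for every integer $p\ge 0$ there is a constant $C=C(\sigma,b,p)>0$ such that $$2\langle \phi, L^*\phi\rangle_p+\|A^*\phi\|_p^2\le C\,\|\phi\|_p^2\qquad\text{for all }\phi\in\mathcal{S}(\mathbb{R}).$$
   Context: ''Smooth function with bounded derivatives'' means a $C^\infty$ function all of whose derivatives of order $\ge 1$ are bounded on $\mathbb{R}$; the function itself may be unbounded (so it grows at most linearly). $\mathcal{S}(\mathbb{R})$ is the Schwartz space of real-valued rapidly decreasing smooth functions on $\mathbb{R}$, and $\partial$ denotes differentiation. The Hermite functions are $h_k(t)=(2^k k!\sqrt{\pi})^{-1/2}e^{-t^2/2}H_k(t)$, $k\ge 0$, where $H_k$ are the (physicists') Hermite polynomials; they form an orthonormal basis of $L^2(\mathbb{R},dx)$, whose inner product is denoted $\langle\cdot,\cdot\rangle_0$. For $p\in\mathbb{R}$ and $f,g\in\mathcal{S}(\mathbb{R})$, the Hermite-Sobolev inner product is $$\langle f,g\rangle_p=\sum_{k=0}^\infty(2k+1)^{2p}\langle f,h_k\rangle_0\langle g,h_k\rangle_0,$$ and $\|f\|_p=\langle f,f\rangle_p^{1/2}$. For $\phi\in\mathcal{S}(\mathbb{R})$, both $A^*\phi$ and $L^*\phi$ are in $\mathcal{S}(\mathbb{R})$. *)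

(* Defs.v *)
From HB Require Import structures.
From mathcomp Require Import all_boot all_order all_algebra.
From mathcomp Require Import all_classical all_reals all_analysis.

Set Implicit Arguments.
Unset Strict Implicit.
Unset Printing Implicit Defensive.

Import Order.TTheory GRing.Theory Num.Theory.
Import numFieldNormedType.Exports.

Local Open Scope classical_set_scope.
Local Open Scope ring_scope.

Definition smooth (R : realType) (f : R -> R) : Prop :=
  forall (n : nat) (x : R), derivable (derive1n n f) x 1.

(* The derivatives of order >= 1 are bounded; f itself need not be. *)
Definition smooth_bounded_derivatives (R : realType) (f : R -> R) : Prop :=
  smooth f /\
  forall n : nat, (1 <= n)%N ->
    exists M : R, forall x : R, `|derive1n n f x| <= M.

Definition schwartz (R : realType) (f : R -> R) : Prop :=
  smooth f /\
  forall m n : nat,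
    exists M : R, forall x : R, `|x ^+ m * derive1n n f x| <= M.

(* Physicists' normalization: H_0 = 1, H_(k+1) = 2 X H_k - H_k'. *)
Fixpoint hermite_poly (R : realType) (k : nat) : {poly R} :=
  if k is k'.+1 then
    2%:R *: ('X * hermite_poly R k') - deriv (hermite_poly R k')
  else 1.

Definition hermite_fun (R : realType) (k : nat) (t : R) : R :=
  (Num.sqrt (2%:R ^+ k * (k`!)%:R * Num.sqrt pi))^-1
  * expR (- (t ^+ 2 / 2%:R)) * (hermite_poly R k).[t].

Definition L2_inner (R : realType) (f g : R -> R) : R :=
  \int[@lebesgue_measure R]_x (f x * g x).

(* The index p is real, hence the real power [`^].  The limit of the partial
   sums is meaningful when the series converges, e.g., for Schwartz f and g. *)
Definition HS_inner (R : realType) (p : R) (f g : R -> R) : R :=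
  limn (series (fun k : nat =>
    (2 * k + 1)%N%:R `^ (2%:R * p)
    * L2_inner f (hermite_fun k) * L2_inner g (hermite_fun k))).

Definition HS_norm (R : realType) (p : R) (f : R -> R) : R :=
  Num.sqrt (HS_inner p f f).

Definition Astar (R : realType) (sigma phi : R -> R) : R -> R :=
  fun x => - derive1 (fun y => sigma y * phi y) x.

Definition Lstar (R : realType) (sigma b phi : R -> R) : R -> R :=
  fun x => 2%:R^-1 * derive1n 2 (fun y => sigma y ^+ 2 * phi y) x
           - derive1 (fun y => b y * phi y) x.

(* Main.v *)
Require Import Defs.
From HB Require Import structures.
From mathcomp Require Import all_boot all_order all_algebra.
From mathcomp Require Import all_classical all_reals all_analysis.
From mathcomp Require Import measurable_realfun ring lra.

Set Implicit Arguments.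
Unset Strict Implicit.
Unset Printing Implicit Defensive.

Import Order.TTheory GRing.Theory Num.Theory.
Import numFieldNormedType.Exports.

Local Open Scope classical_set_scope.
Local Open Scope ring_scope.

(** Let [lower] be the ladder operator x + d/dx on Schwartz functions and
    [inner] the L2 inner product.

    For an integer p >= 0 the Hermite-Sobolev product of f and g is a finite
    combination, with coefficients at least 1, of the L2 products of
    [lower^m f] and [lower^m g] for m <= 2p ([HS_innerE]).  Indeed [lower] maps
    the k-th Hermite function to sqrt(2k) times its predecessor, so that
    [lower^m] has the weights 2^m k (k-1) ... (k-m+1), and (2k+1)^(2p) expands
    positively in these weights ([odd_power_ffact]).  Passing from weighted
    series to integrals is Parseval's identity ([parseval]).  It rests on the
    spectral gap of the harmonic oscillator ([spectral_gap]), which in turn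
    follows from the surjectivity of the adjoint x - d/dx onto the orthogonal
    complement of the Gaussian ([raise_onto]): that equation is solved by an
    explicit integral.

    It is thus enough to bound, for each m and u = [lower^m phi],
    2 <u, lower^m L* phi> + |lower^m A* phi|^2 by the sum of the
    |lower^j phi|^2 over j <= m ([estimate]).  Both commutators
    [lower, d/dx] = -1 and [lower, sigma] = sigma' are of lower order: [order]
    counts how many ladder operators are needed to dominate an operator, where
    d/dx and a multiplier with bounded derivatives count for one, and a bounded
    one for nothing.  After the commutations, the terms which are too large,
    because they carry two derivatives of u or an unbounded coefficient against
    them, cancel exactly between the second-order part of
    2 <u, lower^m L* phi> and |lower^m A* phi|^2 ([second_order_identity]).
    For m = 0 this is the computation
    2 <phi, L* phi> + |A* phi|^2 = <phi, (sigma'^2 - b') phi>; in general, what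
    is left pairs u with operators of the admissible order. *)

(** * Schwartz functions, one derivative at a time *)

Section calculus.
Context {R : realType}.
Implicit Types (f g s : R -> R) (x a b c d : R).

Lemma is_derive1E f x d : is_derive x 1 f d -> (derive1 f) x = d.
Proof. by move=> H; rewrite derive1E derive_val. Qed.

Lemma derivable_is_derive1 f x : derivable f x 1 ->
  is_derive x 1 f ((derive1 f) x).
Proof. by move=> H; rewrite derive1E; exact: derivableP. Qed.

Lemma is_derive1D f g x a b : is_derive x 1 f a -> is_derive x 1 g b ->
  is_derive x 1 (fun y => f y + g y) (a + b).
Proof. exact: is_deriveD. Qed.

Lemma is_derive1N f x a : is_derive x 1 f a ->
  is_derive x 1 (fun y => - f y) (- a).
Proof. exact: is_deriveN. Qed.

Lemma is_derive1M f g x a b : is_derive x 1 f a -> is_derive x 1 g b ->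
  is_derive x 1 (fun y => f y * g y) (a * g x + f x * b).
Proof.
move=> df dg; apply: (is_derive_eq (is_deriveM df dg)).
by rewrite addrC mulrC.
Qed.

Lemma derivable_continuous f : (forall x, derivable f x 1) -> continuous f.
Proof. by move=> df x; exact/differentiable_continuous/derivable1_diffP. Qed.

Definition decaying f := forall m : nat, exists M : R, forall x,
  `|x ^+ m * f x| <= M.

(** Testing Schwartz regularity one derivative at a time lets closure properties
    be proved by induction on [n] from first-order product and chain rules. *)
Fixpoint schwartz_upto n f : Prop :=
  if n is n'.+1 then
    [/\ forall x, derivable f x 1, decaying f & schwartz_upto n' (derive1 f)]
  else True.

Lemma schwartzP f : schwartz f <-> forall n, schwartz_upto n f.
Proof.
split=> [[sf bf] n|H].
  elim: n f sf bf => [//|n IH] f sf bf; split.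
  - exact: (sf 0%N).
  - by move=> m; apply: (bf m 0%N).
  - apply: IH => [k x|m k]; first by have := sf k.+1 x; rewrite derive1Sn.
    by have := bf m k.+1; rewrite derive1Sn.
split=> [n x|m n].
  move: (H n.+1) => {H}; elim: n f => [f []//|n IH] f [_ _ H].
  by rewrite derive1Sn; apply: IH.
move: (H n.+1) => {H}; elim: n f => [f []//|n IH] f [_ _ H].
by rewrite derive1Sn; apply: IH.
Qed.

Lemma schwartz_uptoW n f : schwartz_upto n.+1 f -> schwartz_upto n f.
Proof.
elim: n f => [//|n IH] f [df bf H]; split=> //; exact: IH.
Qed.

Lemma decayingD f g : decaying f -> decaying g -> decaying (fun x => f x + g x).
Proof.
move=> df dg m; have [M HM] := df m; have [N HN] := dg m.
exists (M + N) => x; rewrite mulrDr.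
by apply: (le_trans (ler_normD _ _)); apply: lerD.
Qed.

Lemma decayingZ c f : decaying f -> decaying (fun x => c * f x).
Proof.
move=> df m; have [M HM] := df m.
by exists (`|c| * M) => x; rewrite mulrCA normrM ler_wpM2l.
Qed.

Lemma schwartz_uptoD n f g : schwartz_upto n f -> schwartz_upto n g ->
  schwartz_upto n (fun x => f x + g x).
Proof.
elim: n f g => [//|n IH] f g [df bf Hf] [dg bg Hg].
have D x : is_derive x 1 (fun x => f x + g x) ((derive1 f) x + (derive1 g) x).
  by apply: is_derive1D; apply: derivable_is_derive1.
split.
- by move=> x; have := D x; case.
- exact: decayingD.
- rewrite (_ : derive1 _ = (fun x => (derive1 f) x + (derive1 g) x));
  first exact: IH.
  by apply/funext => x; apply: is_derive1E.
Qed.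

Lemma schwartz_uptoZ n c f : schwartz_upto n f ->
  schwartz_upto n (fun x => c * f x).
Proof.
elim: n f => [//|n IH] f [df bf Hf].
have D x : is_derive x 1 (fun x => c * f x) (c * (derive1 f) x).
  have := is_derive1M (is_derive_cst c x 1) (derivable_is_derive1 (df x)).
  by rewrite mul0r add0r.
split.
- by move=> x; have := D x; case.
- exact: decayingZ.
- rewrite (_ : derive1 _ = (fun x => c * (derive1 f) x)); first exact: IH.
  by apply/funext => x; apply: is_derive1E.
Qed.

Lemma sbd_derivable s : smooth_bounded_derivatives s ->
  forall x, derivable s x 1.
Proof. by move=> [H _] x; exact: (H 0%N). Qed.

Lemma sbd_derive1 s : smooth_bounded_derivatives s ->
  smooth_bounded_derivatives (derive1 s).
Proof.
move=> [H B]; split=> [n x|n n1]; first by rewrite -derive1Sn; apply: H.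
by rewrite -derive1Sn; apply: B.
Qed.

Lemma sbd_derive1_bounded s : smooth_bounded_derivatives s ->
  exists M, forall x, `|(derive1 s) x| <= M.
Proof. by move=> [_ B]; apply: (B 1%N). Qed.

(** The mean value theorem: a bounded derivative gives linear growth. *)
Lemma sbd_growth s : smooth_bounded_derivatives s ->
  exists2 K, 0 <= K & forall x, `|s x| <= K * (1 + `|x|).
Proof.
move=> hs; have [M HM] := sbd_derive1_bounded hs.
have M0 : 0 <= M by apply: le_trans (HM 0); exact: normr_ge0.
have ds := sbd_derivable hs.
have cs := derivable_continuous ds.
have lip a b : a <= b -> `|s b - s a| <= M * (b - a).
  move=> ab.
  have [||c _ ->] := @MVT_segment R s (derive1 s) a b ab.
  - by move=> x _; apply: derivable_is_derive1.
  - exact: continuous_subspaceT.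
  - by rewrite normrM (ger0_norm (x := b - a)) ?subr_ge0// ler_wpM2r ?subr_ge0.
have lip0 x : `|s x - s 0| <= M * `|x|.
  have [x0|x0] := leP 0 x.
    by have := lip _ _ x0; rewrite subr0 (ger0_norm x0).
  by have := lip _ _ (ltW x0); rewrite sub0r distrC (ltr0_norm x0).
exists (`|s 0| + M); first by rewrite addr_ge0.
move=> x; rewrite mulrDr mulr1.
have -> : s x = s 0 + (s x - s 0) by rewrite addrC subrK.
apply: (le_trans (ler_normD _ _)).
rewrite mulrDl -!addrA lerD2l.
apply: (le_trans (lip0 x)).
have := mulr_ge0 (normr_ge0 (s 0)) (normr_ge0 x); lra.
Qed.

Lemma sbd_scale a : smooth_bounded_derivatives (fun x : R => a * x).
Proof.
have D x : is_derive x 1 (fun x : R => a * x) a.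
  have := is_derive1M (is_derive_cst a x 1) (is_derive_id x 1).
  by rewrite mul0r add0r mulr1.
have D0 : derive1 (fun x : R => a * x) = cst a.
  by apply/funext => x; exact: is_derive1E.
have D1 c : derive1 (cst c : R -> R) = cst 0.
  by apply/funext => x; exact: derive1_cst.
have D2 n : derive1n n (cst 0 : R -> R) = cst 0.
  by elim: n => [//|n IH]; rewrite derive1nS IH D1.
have Dn n : derive1n n.+2 (fun x : R => a * x) = cst 0.
  by rewrite 2!derive1Sn D0 D1 D2.
split=> [[|[|n]] x|[|[|n]] _] //.
- by rewrite derive1n1 D0; exact: derivable_cst.
- by rewrite Dn; exact: derivable_cst.
- by exists `|a| => x; rewrite derive1n1 D0.
- by exists 0 => x; rewrite Dn normr0.
Qed.

Lemma sbd_id : smooth_bounded_derivatives (fun x : R => x).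
Proof.
have -> : (fun x : R => x) = (fun x => 1 * x) by apply/funext => x;
  rewrite mul1r.
exact: sbd_scale.
Qed.

Lemma decayingM s f : smooth_bounded_derivatives s -> decaying f ->
  decaying (fun x => s x * f x).
Proof.
move=> /sbd_growth[K K0 HK] df m.
have [M HM] := df m; have [N HN] := df m.+1.
exists (K * (M + N)) => x.
rewrite mulrCA normrM.
apply: (@le_trans _ _ (K * (1 + `|x|) * `|x ^+ m * f x|));
  first exact: ler_wpM2r.
rewrite -mulrA ler_wpM2l// mulrDl mul1r lerD// -normrM mulrA -exprS.
exact: HN.
Qed.

Lemma schwartz_uptoM n s f : smooth_bounded_derivatives s ->
  schwartz_upto n f ->
  schwartz_upto n (fun x => s x * f x).
Proof.
elim: n s f => [//|n IH] s f hs [df bf Hf].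
have D x : is_derive x 1 (fun x => s x * f x) ((derive1 s) x * f x
  + s x * (derive1 f) x).
  by apply: is_derive1M; apply: derivable_is_derive1 => //;
    apply: sbd_derivable.
split.
- by move=> x; have := D x; case.
- exact: decayingM.
- rewrite (_ : derive1 _ = (fun x =>
  (derive1 s) x * f x + s x * (derive1 f) x)).
    apply: schwartz_uptoD; apply: IH => //; first exact: sbd_derive1.
    by apply: schwartz_uptoW; split.
  by apply/funext => x; apply: is_derive1E.
Qed.

Lemma schwartzD f g : schwartz f -> schwartz g -> schwartz (fun x => f x + g x).
Proof.
by move=> /schwartzP hf /schwartzP hg; apply/schwartzP => n;
  apply: schwartz_uptoD.
Qed.

Lemma schwartzZ c f : schwartz f -> schwartz (fun x => c * f x).
Proof.
by move=> /schwartzP hf; apply/schwartzP => n; apply: schwartz_uptoZ.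
Qed.

Lemma schwartzM s f : smooth_bounded_derivatives s -> schwartz f ->
  schwartz (fun x => s x * f x).
Proof.
by move=> hs /schwartzP hf; apply/schwartzP => n; apply: schwartz_uptoM.
Qed.

Lemma schwartz_derive1 f : schwartz f -> schwartz (derive1 f).
Proof. by move=> /schwartzP hf; apply/schwartzP => n; have [] := hf n.+1. Qed.

Lemma schwartz_derivable f : schwartz f -> forall x, derivable f x 1.
Proof. by move=> /schwartzP/(_ 1%N)[]. Qed.

Lemma schwartz_decaying f : schwartz f -> decaying f.
Proof. by move=> /schwartzP/(_ 1%N)[]. Qed.

(** A function of rapid decay is Schwartz as soon as it solves a first-order
    linear equation with Schwartz right-hand side: regularity and decay of the
    derivatives then propagate through the equation. *)
Lemma schwartz_ode s f g : smooth_bounded_derivatives s -> schwartz g ->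
  decaying f -> (forall x, is_derive x 1 f (s x * f x + g x)) -> schwartz f.
Proof.
move=> hs /schwartzP hg bf D; apply/schwartzP; elim=> [//|n IH]; split.
- by move=> x; have := D x; case.
- exact: bf.
- rewrite (_ : derive1 _ = (fun x => s x * f x + g x)).
    by apply: schwartz_uptoD => //; apply: schwartz_uptoM.
  by apply/funext => x; apply: is_derive1E.
Qed.

End calculus.

(** * Integrals of rapidly decreasing functions *)

Section integration.
Context {R : realType}.
Implicit Types (f g h : R -> R) (M x a b : R).
Local Notation mu := (@lebesgue_measure R).

Lemma integrable_oneDsqrV : mu.-integrable setT (EFin \o (fun x : R =>
  (oneDsqr x)^-1)).
Proof.
have cV : continuous (fun x : R => (oneDsqr x)^-1)
  by exact: continuous_oneDsqrV.
have V0 (x : R) : 0 <= (oneDsqr x)^-1.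
  by rewrite invr_ge0; exact: le_trans (oneDsqr_ge1 x).
apply/integrableP; split.
  by apply/measurable_EFinP; exact: continuous_measurable_fun.
under eq_integral => x _ do rewrite /= ger0_norm//.
rewrite (ge0_symfun_integralT (f := (fun x => (oneDsqr x)^-1)))//.
- rewrite -set_itvcy integral0y_oneDsqr -EFinM; exact: ltry.
- by move=> x /=; rewrite /oneDsqr sqrrN.
Qed.

Lemma integrable_decay f M : continuous f ->
  (forall x, `|(1 + x ^+ 2) * f x| <= M) -> mu.-integrable setT (EFin \o f).
Proof.
move=> cf HM.
have M0 : 0 <= M by apply: le_trans (HM 0); exact: normr_ge0.
apply: (@le_integrable _ _ _ mu _ measurableT _
  (fun x => M%:E * ((oneDsqr x)^-1)%:E)%E).
- by apply/measurable_EFinP; exact: continuous_measurable_fun.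
- move=> x _ /=; rewrite lee_fin.
  have p : 0 < oneDsqr x by exact: lt_le_trans (oneDsqr_ge1 x).
  rewrite normrM (ger0_norm M0) normfV (gtr0_norm p).
  rewrite ler_pdivlMr// mulrC.
  by have := HM x; rewrite normrM (gtr0_norm p).
- exact: (integrableZl measurableT _ integrable_oneDsqrV).
Qed.

Lemma cvg_decay0 f (u : nat -> R) M : (forall x, `|(1 + x ^+ 2) * f x| <= M) ->
  (forall n, `|u n| = n.+1%:R) -> f (u n) @[n --> \oo] --> (0:R).
Proof.
move=> HM Hu.
have M0 : 0 <= M by apply: le_trans (HM 0); exact: normr_ge0.
apply/norm_cvg0P.
apply: (@squeeze_cvgr _ _ _ _ (fun=> 0) (fun n => M * harmonic n)).
- near=> n; rewrite normr_ge0 /= /harmonic ler_pdivlMr//.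
  apply: le_trans (HM (u n)).
  rewrite normrM mulrC ler_wpM2r// ger0_norm ?addr_ge0 ?sqr_ge0//.
  rewrite -real_normK ?num_real// Hu.
  have : (0:R) <= n%:R by [].
  rewrite -natr1; nra.
- exact: cvg_cst.
- rewrite -(mulr0 M); apply: cvgMr; exact: cvg_harmonic.
Unshelve. all: by end_near. Qed.

(** On [-n, n] the integral of the derivative is a difference of two values of
    [h] that tend to 0; dominated convergence lets n go to infinity. *)
Lemma Rintegral_derive_decay (h dh : R -> R) (M N : R) :
  (forall x, is_derive x 1 h (dh x)) -> continuous dh ->
    (forall x, `|(1 + x ^+ 2) * h x| <= M) ->
  (forall x, `|(1 + x ^+ 2) * dh x| <= N) -> \int[mu]_x dh x = 0.
Proof.
move=> D cdh HM HN.
have idh := integrable_decay cdh HN.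
pose I n := `[(- n.+1%:R : R), n.+1%:R]%classic.
have ch : continuous h by apply: derivable_continuous => x; have := D x; case.
have FTC n : (\int[mu]_(x in I n) (dh x)%:E)%E = (h n.+1%:R - h (- n.+1%:R))%:E.
  rewrite /I EFinB; apply: continuous_FTC2.
  - by rewrite gtrN.
  - exact: continuous_subspaceT.
  - split.
    + by move=> x _; have := D x; case.
    + by apply: cvg_at_right_filter; exact: ch.
    + by apply: cvg_at_left_filter; exact: ch.
  - by move=> x _; exact: is_derive1E.
have mI n : measurable (I n) by exact: measurable_itv.
have mdh : measurable_fun setT (EFin \o dh).
  by apply/measurable_EFinP; exact: continuous_measurable_fun.
have mf n : measurable_fun setT ((EFin \o dh) \_ (I n)).
  have mn : measurable_fun (I n) (EFin \o dh) by exact: measurable_funTS.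
  exact: (proj1 (measurable_restrictT _ (mI n)) mn).
have f_f : {ae mu, forall x, setT x ->
    ((EFin \o dh) \_ (I n)) x @[n --> \oo] --> (EFin \o dh) x}.
  apply: aeW => x _; apply: cvg_near_cst.
  near=> n; rewrite patchE mem_set// /I /= in_itv/= -ler_norml.
  near: n; exists (Num.truncn `|x|) => // n /= xn.
  rewrite ltW// (lt_le_trans (truncnS_gt _))// ler_nat.
  by rewrite ltnS.
have f_g : {ae mu, forall x n, setT x ->
    (`|((EFin \o dh) \_ (I n)) x| <= `|(dh x)%:E|)%E}.
  apply: aeW => x n _; rewrite patchE; case: ifP => // _.
  by rewrite abse0.
have [_ _ cv] := @dominated_convergence _ _ R mu setT measurableT
  _ _ _ mf mdh f_f (integrable_abse idh) f_g.
have {}cv : (h n.+1%:R - h (- n.+1%:R))%:E @[n --> \oo] -->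
  (\int[mu]_x (dh x)%:E)%E.
  rewrite (_ : (fun n => _) =
    (fun n => (\int[mu]_x ((EFin \o dh) \_ (I n)) x)%E)); first exact: cv.
  by apply/funext => n; rewrite -FTC integral_mkcond.
have c0 : (h n.+1%:R - h (- n.+1%:R))%:E @[n --> \oo] --> (0%:E : \bar R).
  apply: cvg_EFin; first exact: nearW.
  rewrite -(subr0 0); apply: cvgB.
  - apply: (cvg_decay0 (u := fun n => n.+1%:R) HM) => n; exact: normr_nat.
  - by apply: (cvg_decay0 (u := fun n => - n.+1%:R) HM) => n;
    rewrite normrN normr_nat.
by rewrite /Rintegral (cvg_unique _ cv c0).
Unshelve. all: by end_near. Qed.
End integration.

(** * The Schwartz space and its inner product *)

Section schwartz_space.
Variable R : realType.

Definition schwartz_pred : {pred (R -> R)} := fun f => `[< schwartz f >].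

Lemma schwartz_predP f : reflect (schwartz f) (f \in schwartz_pred).
Proof. exact: asboolP. Qed.

Lemma schwartz0 : schwartz (fun _ : R => 0 : R).
Proof.
apply/schwartzP => n.
have dz : derive1 (fun _ : R => 0 : R) = (fun _ => 0).
  by apply/funext => x; exact: derive1_cst.
elim: n => [//|n IH]; split.
- by move=> x; exact: derivable_cst.
- by move=> m; exists 0 => x; rewrite mulr0 normr0.
- by rewrite dz.
Qed.

Fact schwartz_submod : submod_closed schwartz_pred.
Proof.
split; first by apply/schwartz_predP; exact: schwartz0.
move=> c f g /schwartz_predP hf /schwartz_predP hg; apply/schwartz_predP.
by apply: schwartzD => //; apply: schwartzZ.
Qed.

HB.instance Definition _ := GRing.isSubmodClosed.Build R (R -> R) schwartz_pred
  schwartz_submod.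

Record schwartz_space := SchwartzFun {
  schwartz_val :> R -> R; _ : schwartz_val \in schwartz_pred }.

HB.instance Definition _ := [isSub for schwartz_val].
HB.instance Definition _ := [Choice of schwartz_space by <:].
HB.instance Definition _ := [SubChoice_isSubLmodule of schwartz_space by <:].

Lemma schwartz_valP (f : schwartz_space) : schwartz f.
Proof. by apply/schwartz_predP; case: f. Qed.

Definition mk_schwartz f (hf : schwartz f) : schwartz_space :=
  SchwartzFun (introT (schwartz_predP f) hf).

(** The multipliers.  The class is stable under differentiation and contains
    the identity, so that multiplication by x, sigma, b and their derivatives
    are treated at once. *)
Record sbd_fun := SbdFun {
  sbd_val :> R -> R; sbd_valP : smooth_bounded_derivatives sbd_val }.

Definition sbd_deriv (s : sbd_fun) : sbd_fun :=
  SbdFun (sbd_derive1 (sbd_valP s)).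
Definition sbd_X : sbd_fun := SbdFun (@sbd_id R).
End schwartz_space.

Section operators.
Variable R : realType.
Local Notation Sch := (schwartz_space R).
Implicit Types (f g h : Sch) (s t : sbd_fun R) (a x : R).

Lemma schwartz_eq f g : f =1 g -> f = g.
Proof. by move=> fg; apply: val_inj; apply/funext. Qed.

Lemma schwartz_valD f g x : (f + g) x = f x + g x. Proof. by []. Qed.
Lemma schwartz_valZ a f x : (a *: f) x = a * f x. Proof. by []. Qed.
Lemma schwartz_valN f x : (- f) x = - f x. Proof. by []. Qed.

Lemma schwartz_is_derive f x : is_derive x 1 f (derive1 f x).
Proof.
by apply: derivable_is_derive1; apply: schwartz_derivable; exact: schwartz_valP.
Qed.

Definition ddx f : Sch := mk_schwartz (schwartz_derive1 (schwartz_valP f)).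
Definition mulby s f : Sch := mk_schwartz
  (schwartzM (sbd_valP s) (schwartz_valP f)).

Lemma ddx_linear : linear ddx.
Proof.
move=> a f g; apply: schwartz_eq => x.
rewrite schwartz_valD schwartz_valZ; apply: is_derive1E.
apply: (is_derive1D (f := fun y => a * f y)); last exact: schwartz_is_derive.
have := is_derive1M (is_derive_cst a x 1) (schwartz_is_derive f x).
by rewrite mul0r add0r.
Qed.
HB.instance Definition _ := GRing.isLinear.Build R Sch Sch *:%R ddx ddx_linear.

Lemma mulby_linear s : linear (mulby s).
Proof.
move=> a f g; apply: schwartz_eq => x.
have E u : mulby s u x = s x * u x by [].
by rewrite !(E, schwartz_valD, schwartz_valZ); ring.
Qed.
HB.instance Definition _ s :=
  GRing.isLinear.Build R Sch Sch *:%R (mulby s) (mulby_linear s).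

Lemma ddxD f g : ddx (f + g) = ddx f + ddx g. Proof. exact: linearD. Qed.
Lemma ddxZ a f : ddx (a *: f) = a *: ddx f. Proof. exact: linearZ. Qed.
Lemma ddx0 : ddx 0 = 0. Proof. exact: linear0. Qed.
Lemma mulby0 s : mulby s 0 = 0. Proof. exact: linear0. Qed.
Lemma ddxN f : ddx (- f) = - ddx f. Proof. exact: linearN. Qed.
Lemma mulbyD s f g : mulby s (f + g) = mulby s f + mulby s g.
Proof. exact: linearD. Qed.
Lemma mulbyZ s a f : mulby s (a *: f) = a *: mulby s f.
Proof. exact: linearZ. Qed.
Lemma mulbyN s f : mulby s (- f) = - mulby s f. Proof. exact: linearN. Qed.

Lemma mulbyC s t f : mulby s (mulby t f) = mulby t (mulby s f).
Proof. by apply: schwartz_eq => x /=; rewrite mulrCA. Qed.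

Lemma ddx_mulby s f : ddx (mulby s f) = mulby (sbd_deriv s) f + mulby s (ddx f).
Proof.
apply: schwartz_eq => x; rewrite schwartz_valD /=; apply: is_derive1E.
apply: is_derive1M; last exact: schwartz_is_derive.
by apply: derivable_is_derive1; apply: sbd_derivable; exact: sbd_valP.
Qed.

Lemma mulby_deriv_X f : mulby (sbd_deriv (sbd_X R)) f = f.
Proof.
apply: schwartz_eq => x /=.
by rewrite (is_derive1E (is_derive_id x (1:R))) mul1r.
Qed.

Local Notation mu := (@lebesgue_measure R).

Definition inner f g : R := L2_inner f g.

Lemma schwartz_continuous f : continuous f.
Proof.
by apply: derivable_continuous; apply: schwartz_derivable; exact: schwartz_valP.
Qed.

Lemma schwartz_mul_decay f g : exists M, forall x,
  `|(1 + x ^+ 2) * (f x * g x)| <= M.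
Proof.
have [M HM] := schwartz_decaying (schwartz_valP f) 0.
have [N0 HN0] := schwartz_decaying (schwartz_valP g) 0.
have [N2 HN2] := schwartz_decaying (schwartz_valP g) 2.
exists (M * (N0 + N2)) => x; rewrite mulrCA normrM ler_pM//.
  by have := HM x; rewrite expr0 mul1r.
rewrite mulrDl; apply: (le_trans (ler_normD _ _)); apply: lerD => //.
by have := HN0 x; rewrite expr0.
Qed.

Lemma inner_integrable f g : mu.-integrable setT (EFin \o (fun x => f x * g x)).
Proof.
have [M HM] := schwartz_mul_decay f g.
apply: integrable_decay HM => x; apply: cvgM; exact: schwartz_continuous.
Qed.

Lemma innerC f g : inner f g = inner g f.
Proof. by apply: eq_Rintegral => x _; rewrite mulrC. Qed.

Lemma inner_linear f : linear_for *%R (inner f).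
Proof.
move=> a g h; rewrite /inner /L2_inner.
under eq_Rintegral => x _ do rewrite schwartz_valD schwartz_valZ mulrDr mulrCA.
rewrite RintegralD//; last exact: inner_integrable.
  by rewrite RintegralZl//; exact: inner_integrable.
exact: (integrableZl measurableT a (inner_integrable f g)).
Qed.
HB.instance Definition _ f := GRing.isLinear.Build R Sch R *%R (inner f)
  (inner_linear f).

Lemma innerDr f g h : inner f (g + h) = inner f g + inner f h.
Proof. exact: linearD. Qed.
Lemma innerZr a f g : inner f (a *: g) = a * inner f g.
Proof. exact: linearZ. Qed.
Lemma innerNr f g : inner f (- g) = - inner f g. Proof. exact: linearN. Qed.
Lemma inner0r f : inner f 0 = 0. Proof. exact: linear0. Qed.
Lemma innerDl f g h : inner (f + g) h = inner f h + inner g h.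
Proof. by rewrite innerC innerDr !(innerC h). Qed.
Lemma innerZl a f g : inner (a *: f) g = a * inner f g.
Proof. by rewrite innerC innerZr (innerC g). Qed.
Lemma innerNl f g : inner (- f) g = - inner f g.
Proof. by rewrite innerC innerNr (innerC g). Qed.
Lemma inner0l f : inner 0 f = 0. Proof. by rewrite innerC inner0r. Qed.

Lemma inner_ge0 f : 0 <= inner f f.
Proof. by apply: Rintegral_ge0 => x _; rewrite -expr2 sqr_ge0. Qed.

Lemma inner_mulby s f g : inner (mulby s f) g = inner f (mulby s g).
Proof. by apply: eq_Rintegral => x _ /=; rewrite mulrCA mulrA. Qed.

(** The boundary terms of the integration by parts vanish by decay. *)
Lemma inner_ddx f g : inner (ddx f) g = - inner f (ddx g).
Proof.
apply/eqP; rewrite -addr_eq0; apply/eqP.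
rewrite -RintegralD//; try exact: inner_integrable.
have [M HM] := schwartz_mul_decay f g.
have [N1 H1] := schwartz_mul_decay (ddx f) g.
have [N2 H2] := schwartz_mul_decay f (ddx g).
apply: (@Rintegral_derive_decay _ (fun x => f x * g x) _ M (N1 + N2)) => //.
- by move=> x; apply: is_derive1M; exact: schwartz_is_derive.
- by move=> x; apply: cvgD; apply: cvgM; exact: schwartz_continuous.
- move=> x; rewrite mulrDr; apply: (le_trans (ler_normD _ _)); exact: lerD.
Qed.

Lemma inner_ddxr f g : inner f (ddx g) = - inner (ddx f) g.
Proof. by rewrite inner_ddx opprK. Qed.

End operators.

(** * The Gaussian and the range of the raising operator *)

Section gaussian.
Variable R : realType.
Local Notation Sch := (schwartz_space R).
Implicit Types (f g h : Sch) (s : sbd_fun R) (a x t : R) (m : nat).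
Local Notation mu := (@lebesgue_measure R).

Local Notation gauss := (fun x : R => expR (- (x ^+ 2 / 2))).

Lemma is_derive_expR_comp (u : R -> R) x a : is_derive x 1 u a ->
  is_derive x 1 (fun y => expR (u y)) (a * expR (u x)).
Proof.
by move=> du; rewrite mulrC; exact: (is_derive1_comp (is_derive_expR (u x)) du).
Qed.

Lemma is_derive_half_sqr x : is_derive x 1 (fun y : R => y ^+ 2 / 2) x.
Proof.
have H := is_derive1M (is_derive1M (is_derive_id x 1) (is_derive_id x 1))
  (is_derive_cst (2^-1 : R) x 1).
rewrite (_ : (fun y => _) = (fun y : R => y * y * 2^-1)); last by [].
by apply: (is_derive_eq H); rewrite /cst; field.
Qed.

Lemma is_derive_gauss x : is_derive x 1 gauss (- x * gauss x).
Proof. exact: is_derive_expR_comp (is_derive1N (is_derive_half_sqr x)). Qed.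

Lemma schwartz_gauss : schwartz gauss.
Proof.
apply: (@schwartz_ode _ (fun x => -1 * x) _ (fun=> 0)).
- exact: sbd_scale.
- exact: schwartz0.
- move=> m; exists (1 + 2 ^+ m.+1 * m.+1`!%:R) => x.
  rewrite normrM normrX (gtr0_norm (expR_gt0 _)) expRN.
  set t := x ^+ 2 / 2; have t0 : 0 <= t by rewrite divr_ge0// sqr_ge0.
  rewrite ler_pdivrMr ?expR_gt0//.
  (* For |x| <= 1 the value 1 suffices; beyond, x^m <= (x^2)^(m+1), and one term
     of the exponential series at t absorbs it. *)
  have E1 : 1 <= expR t by rewrite -expR0 ler_expR.
  have F0 : 0 < m.+1`!%:R :> R by rewrite ltr0n fact_gt0.
  have Et : t ^+ m.+1 <= m.+1`!%:R * expR t.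
    rewrite mulrC -ler_pdivrMr//; apply: le_trans (expR_ge1Dxn m t0).
    by rewrite lerDr.
  have x2 : (`|x| ^+ 2) ^+ m.+1 <= 2 ^+ m.+1 * m.+1`!%:R * expR t.
    rewrite real_normK ?num_real// (_ : x ^+ 2 = 2 * t); last first.
      by rewrite /t mulrC divfK ?pnatr_eq0.
    by rewrite exprMn -mulrA ler_wpM2l// exprn_ge0.
  rewrite mulrDl mul1r; have [x1|x1] := leP `|x| 1.
    apply: (@le_trans _ _ 1); first exact: exprn_ile1.
    apply: (le_trans E1); rewrite lerDl.
    by rewrite !mulr_ge0 ?exprn_ge0 ?expR_ge0.
  apply: (@le_trans _ _ ((`|x| ^+ 2) ^+ m.+1)).
    by rewrite -exprM ler_weXn2l ?ltW// (leq_trans (leqnSn m))// leq_pmull.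
  by apply: (le_trans x2); rewrite lerDr expR_ge0.
- move=> x; rewrite addr0 mulN1r; exact: is_derive_gauss.
Qed.

Definition gaussian : Sch := mk_schwartz schwartz_gauss.

Definition lower f := mulby (sbd_X R) f + ddx f.
Definition raise f := mulby (sbd_X R) f - ddx f.

Lemma schwartz_integrable f : mu.-integrable setT (EFin \o f).
Proof.
have [M0 H0] := schwartz_decaying (schwartz_valP f) 0.
have [M2 H2] := schwartz_decaying (schwartz_valP f) 2.
apply: (@integrable_decay _ _ (M0 + M2)); first exact: schwartz_continuous.
move=> x; rewrite mulrDl; apply: (le_trans (ler_normD _ _)); apply: lerD => //.
by have := H0 x; rewrite expr0.
Qed.

Lemma iter_mulby_X m g x : iter m (mulby (sbd_X R)) g x = x ^+ m * g x.
Proof.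
elim: m => [|m IH]; first by rewrite expr0 mul1r.
by rewrite iterS exprS -mulrA -IH.
Qed.

(** On a set lying farther from the origin than [x] the Gaussian weight is at
    most its value at [x], and [|x|^m] at most [|t|^m]. *)
Lemma gaussian_tail m g x (A : set R) : measurable A ->
  (forall t, A t -> `|x| <= `|t|) ->
  `|x ^+ m * (expR (x ^+ 2 / 2) * \int[mu]_(t in A) (gaussian t * g t))|
    <= \int[mu]_t `|iter m (mulby (sbd_X R)) g t|.
Proof.
move=> mA xA.
have iT := inner_integrable gaussian g.
have iA : mu.-integrable A (EFin \o (fun t => gaussian t * g t)).
  exact: integrableS iT.
set G := iter m _ g.
have nG : mu.-integrable setT (EFin \o (fun t => `|G t|)).
  exact: (integrable_norm (schwartz_integrable G)).
have nGA : mu.-integrable A (EFin \o (fun t => `|G t|)) by exact: integrableS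
  nG.
apply: (@le_trans _ _ (\int[mu]_(t in A) `|G t|)); last first.
  have -> : \int[mu]_(t in A) `|G t| =
    fine (\int[mu]_(t in A) `|G t|%:E)%E by [].
  apply: fine_le.
  - exact: integrable_fin_num nGA.
  - exact: integrable_fin_num nG.
  - apply: ge0_subset_integral => //.
    by have /integrableP[] := nG.
rewrite mulrA normrM; set c := `|x ^+ m * _|.
have c0 : 0 <= c by exact: normr_ge0.
apply: (le_trans (ler_wpM2l c0 (@le_normr_Rintegral _ _ R mu A _ mA iA))).
rewrite -RintegralZl//; last exact: integrable_norm.
apply: le_Rintegral => //.
  exact: (@integrableZl _ _ R mu A mA c _ (integrable_norm iA)).
move=> t At; rewrite /G iter_mulby_X /c normrM normrX normrM mulrA normrM
  normrX.
rewrite ler_wpM2r//.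
rewrite !(gtr0_norm (expR_gt0 _)) -mulrA -expRD.
rewrite -[leRHS]mulr1 ler_pM ?exprn_ge0 ?expR_ge0 ?lerXn2r ?nnegrE ?xA//.
rewrite -expR0 ler_expR subr_le0 ler_wpM2r//.
by rewrite -(real_normK (num_real x)) -(real_normK (num_real t)) lerXn2r ?nnegrE
  ?xA.
Qed.

(** The equation x w - w' = g says that w exp(-x^2/2) is a primitive of
    - g exp(-x^2/2).  The primitive vanishing at minus infinity also vanishes at
    plus infinity by orthogonality to the Gaussian, so on each half-line w is
    given by an integral over points farther from 0 than x, hence decays. *)
Lemma raise_onto g : inner gaussian g = 0 -> exists w, raise w = g.
Proof.
move=> g0.
pose k (t : R) := gaussian t * g t.
pose F x := \int[mu]_(t in [set` Interval (BInfty R true) (BRight x)]) k t.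
pose w x := - (expR (x ^+ 2 / 2) * F x).
have iT : mu.-integrable setT (EFin \o k) := inner_integrable gaussian g.
have ck : continuous k by move=> x; apply: cvgM; exact: schwartz_continuous.
have dF x : is_derive x 1 F (k x).
  have [||||dFx Fx] := @continuous_FTC1 R k (BInfty R true) x (x + 1).
  - by rewrite ltrDl.
  - exact: integrableS iT.
  - exact: ltNyr.
  - exact: ck.
  - by rewrite -Fx; exact: derivable_is_derive1.
have dw x : is_derive x 1 w (x * w x + - g x).
  have := is_derive1N (is_derive1M
    (is_derive_expR_comp (is_derive_half_sqr x)) (dF x)).
  rewrite -/(w x) => /is_derive_eq; apply.
  have -> : expR (x ^+ 2 / 2) * k x = g x.
    by rewrite /k mulrA -expRD subrr expR0 mul1r.
  by rewrite /w; ring.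
have FE x : F x = - \int[mu]_(t in [set` Interval (BRight x) (BInfty R false)])
  k t.
  rewrite -(@Rintegral_itvB _ k (BInfty R true) (BInfty R false) x)//;
    last exact: integrableS iT.
  rewrite -/(F x) set_itvNyy.
  by move: g0; rewrite /inner /L2_inner -/k => ->; rewrite sub0r opprK.
have bw : decaying w.
  move=> m; exists (\int[mu]_t `|iter m (mulby (sbd_X R)) g t|) => x.
  rewrite /w mulrN normrN; have [x0|x0] := leP x 0.
    apply: gaussian_tail => [|t]; first exact: measurable_itv.
    rewrite /= in_itv/= => tx.
    by rewrite (ler0_norm x0) (ler0_norm (le_trans tx x0)) lerN2.
  rewrite FE !mulrN normrN.
  apply: gaussian_tail => [|t]; first exact: measurable_itv.
  rewrite /= in_itv/= andbT => xt.
  by rewrite (gtr0_norm x0) (gtr0_norm (lt_trans x0 xt)) ltW.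
have sw : schwartz w.
  apply: (@schwartz_ode _ id _ (- g : Sch)) => //; first exact: sbd_id.
  exact: schwartz_valP.
exists (mk_schwartz sw); apply: schwartz_eq => x.
rewrite /raise schwartz_valD schwartz_valN /=.
by rewrite (is_derive1E (dw x)) opprD opprK addNKr.
Qed.
End gaussian.

(** * Hermite functions and Parseval's identity *)

Section ladder.
Variable R : realType.
Local Notation Sch := (schwartz_space R).
Local Notation low m := (iter m (@lower R)).
Implicit Types (f g h : Sch) (s : sbd_fun R) (a x t : R) (j k m n : nat).

Lemma lower_linear : linear (@lower R).
Proof.
by move=> a f g; rewrite /lower mulbyD mulbyZ ddxD ddxZ scalerDr addrACA.
Qed.
HB.instance Definition _ := GRing.isLinear.Build R Sch Sch *:%R (@lower R)
  lower_linear.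

Lemma lowerD f g : lower (f + g) = lower f + lower g.
Proof. exact: linearD. Qed.
Lemma lowerZ a f : lower (a *: f) = a *: lower f. Proof. exact: linearZ. Qed.
Lemma lowerN f : lower (- f) = - lower f. Proof. exact: linearN. Qed.

Lemma raise_linear : linear (@raise R).
Proof.
by move=> a f g; rewrite /raise mulbyD mulbyZ ddxD ddxZ scalerBr opprD addrACA.
Qed.
HB.instance Definition _ := GRing.isLinear.Build R Sch Sch *:%R (@raise R)
  raise_linear.

Lemma raiseZ a f : raise (a *: f) = a *: raise f. Proof. exact: linearZ. Qed.

(** [lower] and [raise] are adjoint to each other. *)
Lemma inner_lower f g : inner (lower f) g = inner f (raise g).
Proof.
by rewrite /lower /raise innerDl innerDr innerNr inner_mulby inner_ddx.
Qed.

Lemma lower_mulby s f : lower (mulby s f) =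
  mulby s (lower f) + mulby (sbd_deriv s) f.
Proof.
rewrite /lower ddx_mulby mulbyD mulbyC -!addrA; congr (_ + _).
exact: addrC.
Qed.

Lemma lower_ddx f : lower (ddx f) = ddx (lower f) - f.
Proof.
by rewrite /lower ddxD ddx_mulby mulby_deriv_X -[f + _ + _]addrA [f
  + _]addrC addrK.
Qed.

(** The canonical commutation relation. *)
Lemma lower_raise f : lower (raise f) = raise (lower f) + 2 *: f.
Proof.
rewrite {2}/raise {1}/raise lowerD lowerN lower_mulby lower_ddx mulby_deriv_X
  opprB addrA.
by rewrite scaler_nat mulr2n -!addrA; congr (_ + _); rewrite addrA addrC.
Qed.

Lemma inner_raise f g : inner (raise f) g = inner f (lower g).
Proof. by rewrite innerC -inner_lower innerC. Qed.

Lemma raise_norm f : inner (raise f) (raise f) =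
  inner (lower f) (lower f) + 2 * inner f f.
Proof. by rewrite inner_raise lower_raise innerDr innerZr -inner_lower. Qed.

Lemma lower_gaussian : lower (gaussian R) = 0.
Proof.
apply: schwartz_eq => x; rewrite /lower schwartz_valD /=.
by rewrite (is_derive1E (is_derive_gauss x)) mulNr addrN.
Qed.

Definition hermite_norm k : R := Num.sqrt (2%:R ^+ k * (k`!)%:R * Num.sqrt pi).
Definition herm k : Sch := (hermite_norm k)^-1 *: iter k (@raise R)
  (gaussian R).

(** The recurrence that defines the Hermite polynomials is the action of
    [raise] on a polynomial times the Gaussian. *)
Lemma iter_raise_gaussian k x : iter k (@raise R) (gaussian R) x =
  expR (- (x ^+ 2 / 2)) * (hermite_poly R k).[x].
Proof.
elim: k x => [|k IH] x; first by rewrite /= hornerC mulr1.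
rewrite iterS; set u := iter k _ _ in IH *.
rewrite /raise schwartz_valD schwartz_valN /= -/u.
have -> : schwartz_val u = (fun y =>
  expR (- (y ^+ 2 / 2)) * (hermite_poly R k).[y]).
  exact/funext.
rewrite (is_derive1E (is_derive1M (is_derive_gauss x) (is_derive_poly _ x))).
by rewrite !hornerE /=; ring.
Qed.

Lemma hermE k x : herm k x = hermite_fun k x.
Proof. by rewrite /herm schwartz_valZ iter_raise_gaussian mulrA. Qed.

(** The coefficient by which the ladder operators link two consecutive Hermite
    functions. *)
Definition ladder k : R := Num.sqrt (2 * k.+1%:R).

Lemma ladder_gt0 k : 0 < ladder k. Proof. by rewrite sqrtr_gt0 mulr_gt0. Qed.
Lemma ladder_neq0 k : ladder k != 0. Proof. by rewrite gt_eqF// ladder_gt0. Qed.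
Lemma ladder_sqr k : ladder k ^+ 2 = 2 * k.+1%:R.
Proof. by rewrite sqr_sqrtr// mulr_ge0. Qed.

Lemma hermite_norm_gt0 k : 0 < hermite_norm k.
Proof.
by rewrite sqrtr_gt0 !mulr_gt0 ?exprn_gt0 ?ltr0n ?fact_gt0// sqrtr_gt0 pi_gt0.
Qed.

Lemma hermite_normS k : hermite_norm k.+1 = ladder k * hermite_norm k.
Proof.
rewrite -sqrtrM ?mulr_ge0//; congr Num.sqrt.
by rewrite exprS factS natrM; ring.
Qed.

Lemma raise_herm k : raise (herm k) = ladder k *: herm k.+1.
Proof.
rewrite /herm raiseZ iterS scalerA hermite_normS invfM mulVKf//.
exact: ladder_neq0.
Qed.

Lemma lower_herm0 : lower (herm 0) = 0.
Proof. by rewrite /herm lowerZ lower_gaussian scaler0. Qed.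

Lemma lower_herm k : lower (herm k.+1) = ladder k *: herm k.
Proof.
elim: k => [|k IH]; [apply: (scalerI (ladder_neq0 0)) |
  apply: (scalerI (ladder_neq0 k.+1))].
  rewrite -lowerZ -raise_herm lower_raise lower_herm0 linear0 add0r [RHS]scalerA
    -expr2 ladder_sqr.
  by rewrite mulr1.
rewrite -lowerZ -raise_herm lower_raise IH raiseZ raise_herm
  !(scalerA _ _ (herm _)) -scalerDl -!expr2 !ladder_sqr.
by congr (_ *: _); rewrite -[k.+2%:R]natr1; ring.
Qed.

Lemma herm0_norm : inner (herm 0) (herm 0) = 1.
Proof.
rewrite /herm innerZl innerZr /=.
have -> : inner (gaussian R) (gaussian R) = Num.sqrt pi.
  have -> : Num.sqrt pi = fine (Num.sqrt pi : R)%:E by [].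
  rewrite -integralT_gauss; congr fine; apply: eq_integral => x _; congr EFin.
  by rewrite /= -expRD /gauss_fun; congr expR; field.
rewrite mulrA -expr2 exprVn /hermite_norm expr0 fact0 !mul1r.
by rewrite sqr_sqrtr ?sqrtr_ge0// mulVf// gt_eqF// sqrtr_gt0 pi_gt0.
Qed.

Lemma herm_orthonormal j k : inner (herm j) (herm k) = (j == k)%:R.
Proof.
have H0 k' : inner (herm 0) (herm k'.+1) = 0.
  apply: (mulfI (ladder_neq0 k')); rewrite mulr0 -innerZr -raise_herm
    -inner_lower lower_herm0.
  exact: inner0l.
elim: j k => [|j IH] [|k].
- exact: herm0_norm.
- exact: H0.
- by rewrite innerC H0.
- apply: (mulfI (ladder_neq0 k)); rewrite -innerZr -raise_herm -inner_lower
  lower_herm innerZl IH eqSS.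
  by case: eqVneq => [->//|_]; rewrite !mulr0.
Qed.

Definition hcoef k f : R := inner f (herm k).

Lemma hcoef_lower k f : hcoef k (lower f) = ladder k * hcoef k.+1 f.
Proof. by rewrite /hcoef inner_lower raise_herm innerZr. Qed.

Lemma hcoefB k f g : hcoef k (f - g) = hcoef k f - hcoef k g.
Proof. by rewrite /hcoef innerDl innerNl. Qed.

Lemma hcoefD k f g : hcoef k (f + g) = hcoef k f + hcoef k g.
Proof. exact: innerDl. Qed.

Lemma inner_CauchySchwarz f g : inner f g ^+ 2 <= inner f f * inner g g.
Proof.
have H (a b : R) : 0 <= a ^+ 2 * inner f f + 2 * a * b * inner f g
  + b ^+ 2 * inner g g.
  have := inner_ge0 (a *: f + b *: g).
  rewrite !innerDl !innerDr !innerZl !innerZr (innerC g f); lra.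
have [g0|g0] := eqVneq (inner g g) 0.
  suff -> : inner f g = 0 by rewrite expr0n g0 mulr0.
  apply/eqP; apply: contraT => fg0.
  have := H (-(1)) ((1 + inner f f) / (2 * inner f g)).
  rewrite g0; have -> : 2 * (-1) * ((1 + inner f f) / (2 * inner f g)) * inner f
    g = - (1 + inner f f).
    by field.
  by rewrite mulr0 sqrrN expr1n; lra.
have gp : 0 < inner g g by rewrite lt0r g0 inner_ge0.
have := H (inner g g) (- inner f g); set A := inner f f; set B := inner f g;
  set G := inner g g.
have -> : G ^+ 2 * A + 2 * G * - B * B + (- B) ^+ 2 * G =
  G * (A * G - B ^+ 2) by ring.
by rewrite pmulr_rge0// subr_ge0.
Qed.

(** Induction on [n].  Write g = [raise w]; then w is orthogonal to one Hermite
    function fewer, so |g|^2 = |lower w|^2 + 2 |w|^2 >= 2 (n+1) |w|^2, while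
    |g|^2 = <w, lower g> <= |w| |lower g|. *)
Lemma spectral_gap n g : (forall k, (k < n)%N -> hcoef k g = 0) ->
  2 * n%:R * inner g g <= inner (lower g) (lower g).
Proof.
elim: n g => [|n IH] g gk; first by rewrite mulr0 mul0r inner_ge0.
have [|w wg] := @raise_onto R g.
  have := gk 0%N isT; rewrite /hcoef /herm innerZr innerC => /eqP.
  by rewrite mulf_eq0 invr_eq0 gt_eqF ?hermite_norm_gt0//= => /eqP.
have wk k : (k < n)%N -> hcoef k w = 0.
  move=> kn; apply: (mulfI (ladder_neq0 k)).
  by rewrite mulr0 /hcoef -innerZr -lower_herm innerC inner_lower wg innerC;
    exact: gk.
have := IH w wk.
have := raise_norm w; rewrite wg.
have : inner g g = inner w (lower g) by rewrite -{1}wg inner_raise.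
have := inner_CauchySchwarz w (lower g).
have := inner_ge0 g; have := inner_ge0 w; have := inner_ge0 (lower g).
have := inner_ge0 (lower w).
move: (inner g g) (inner w w) (inner (lower g) (lower g))
  (inner (lower w) (lower w)) (inner w (lower g)).
move=> G W A B C B0 A0 W0 G0 CS GC GB Bn; rewrite -[n.+1%:R]natr1.
have [->|Gn] := eqVneq G 0; first by rewrite mulr0.
have Gp : 0 < G by rewrite lt0r Gn G0.
have GW : 2 * (n%:R + 1) * W <= G by rewrite GB; lra.
rewrite -(ler_pM2l Gp).
apply: (@le_trans _ _ (2 * (n%:R + 1) * W * A)).
  have n0 : 0 <= 2 * (n%:R + 1) :> R by rewrite mulr_ge0// addr_ge0.
  by rewrite mulrCA -expr2 -[leRHS]mulrA GC; exact: ler_wpM2l.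
exact: ler_wpM2r.
Qed.

Lemma inner_sumr n f (F : 'I_n -> Sch) : inner f (\sum_k F k) =
  \sum_k inner f (F k).
Proof. exact: linear_sum. Qed.

Lemma lower_sum n (F : 'I_n -> Sch) : lower (\sum_k F k) = \sum_k lower (F k).
Proof. exact: linear_sum. Qed.

Definition hproj n f : Sch := \sum_(k < n) hcoef k f *: herm k.

Lemma hcoef_hproj n f k : (k < n)%N -> hcoef k (hproj n f) = hcoef k f.
Proof.
move=> kn; rewrite /hcoef innerC inner_sumr (bigD1 (Ordinal kn))//= big1 ?addr0.
  by rewrite innerZr herm_orthonormal eqxx mulr1.
move=> i ik; rewrite innerZr herm_orthonormal; case: eqP => [e|_];
  last by rewrite mulr0.
by case/eqP: ik; apply: val_inj.
Qed.

Lemma inner_hproj n f g : inner (hproj n f) g =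
  \sum_(k < n) hcoef k f * hcoef k g.
Proof.
by rewrite innerC inner_sumr; apply: eq_bigr => k _; rewrite innerZr.
Qed.

Lemma lower_hproj n f : lower (hproj n.+1 f) = hproj n (lower f).
Proof.
rewrite /hproj big_ord_recl lowerD lowerZ lower_herm0 scaler0 add0r lower_sum.
apply: eq_bigr => k _; rewrite lowerZ lower_herm scalerA hcoef_lower mulrC.
by rewrite lift0.
Qed.

Lemma remainder_norm n f : inner (f - hproj n f) (f - hproj n f) =
  inner f f - \sum_(k < n) hcoef k f ^+ 2.
Proof.
have E : inner (hproj n f) (f - hproj n f) = 0.
  rewrite inner_hproj big1// => k _.
  by rewrite hcoefB hcoef_hproj ?ltn_ord// subrr mulr0.
rewrite {1}innerDl innerNl E subr0 innerDr innerNr innerC inner_hproj.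
by congr (_ - _); apply: eq_bigr => k _; rewrite expr2.
Qed.

(** The remainder is orthogonal to the first n+1 Hermite functions, and
    [lower] sends it to a remainder of [lower f], of norm at most |lower f|:
    the spectral gap gives an explicit rate of convergence. *)
Lemma remainder_le n f :
  2 * n.+1%:R * inner (f - hproj n.+1 f) (f - hproj n.+1 f) <=
    inner (lower f) (lower f).
Proof.
apply: (le_trans (spectral_gap (n := n.+1) _)) => [k kn|].
  by rewrite hcoefB hcoef_hproj// subrr.
rewrite lowerD lowerN lower_hproj remainder_norm lerBlDr lerDl sumr_ge0// =>
  k _.
exact: sqr_ge0.
Qed.

Lemma parseval_norm f : (fun n => \sum_(k < n) hcoef k f ^+ 2) @ \oo -->
  inner f f.
Proof.
rewrite -cvg_shiftS.
apply: (@squeeze_cvgr _ _ _ _ (fun n =>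
  inner f f - inner (lower f) (lower f) * harmonic n)
  (fun=> inner f f)).
- near=> n.
  have H := remainder_le n f; rewrite remainder_norm in H.
  have R0 : 0 <= inner f f - \sum_(k < n.+1) hcoef k f ^+ 2.
    by rewrite -remainder_norm inner_ge0.
  rewrite /= /harmonic lerBlDr -lerBlDl ler_pdivlMr// -[X in _ && X]subr_ge0 R0
    andbT.
  apply: le_trans H; rewrite mulrC ler_wpM2r// -[leLHS]mul1r.
  by rewrite ler_wpM2r// ler1n.
- rewrite -[X in _ --> X]subr0; apply: cvgB; first exact: cvg_cst.
  by rewrite -(mulr0 (inner (lower f) (lower f))); apply: cvgMr;
    exact: cvg_harmonic.
- exact: cvg_cst.
Unshelve. all: by end_near. Qed.

(** Polarization. *)
Lemma parseval f g : (fun n => \sum_(k < n) hcoef k f * hcoef k g) @ \oo -->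
  inner f g.
Proof.
have E (a b : R) : a * b = ((a + b) ^+ 2 - (a - b) ^+ 2) / 4 by field.
have -> : inner f g = (inner (f + g) (f + g) - inner (f - g) (f - g)) / 4.
  by rewrite !innerDl !innerDr !innerNl !innerNr (innerC g f); field.
rewrite (_ : (fun n => _) = (fun n => (\sum_(k < n) hcoef k (f + g) ^+ 2 -
  \sum_(k < n) hcoef k (f - g) ^+ 2) / 4)).
  apply: cvgMl; apply: cvgB; exact: parseval_norm.
apply/funext => n; rewrite -sumrB mulr_suml; apply: eq_bigr => k _.
by rewrite E hcoefD hcoefB.
Qed.

(** Since the k-th coefficient of [lower f] is sqrt(2k+2) times the next
    coefficient of f, each application of [lower] shifts the series by one and
    multiplies the weight by one more factor. *)
Lemma parseval_lower m f g :
  (fun n => \sum_(k < n) 2 ^+ m * (k ^_ m)%:R * (hcoef k f * hcoef k g)) @ \oo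
    -->
  inner (low m f) (low m g).
Proof.
elim: m f g => [|m IH] f g.
  rewrite (_ : (fun n => _) = (fun n => \sum_(k < n) hcoef k f * hcoef k g)).
    exact: parseval.
  by apply/funext => n; apply: eq_bigr => k _; rewrite expr0 ffactn0 !mul1r.
rewrite !iterSr -cvg_shiftS (_ : (fun n => _) = (fun n => \sum_(k < n)
  2 ^+ m * (k ^_ m)%:R * (hcoef k (lower f) * hcoef k (lower g))));
    first exact: IH.
apply/funext => n; rewrite big_ord_recl /= ffact0n mulr0 mul0r add0r.
apply: eq_bigr => k _; rewrite /bump leq0n add1n ffactSS !hcoef_lower natrM
  exprS.
transitivity (2 ^+ m * (k ^_ m)%:R * ladder k ^+ 2
  * (hcoef k.+1 f * hcoef k.+1 g)).
  by rewrite ladder_sqr; ring.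
by ring.
Qed.

(** By induction on the power, from
    (2k+1) 2^m k^_m = 2^(m+1) k^_(m+1) + (2m+1) 2^m k^_m.  The lower bound 1 is
    what makes the Sobolev norm dominate each |lower^m f|. *)
Lemma odd_power_ffact n : exists gam : nat -> R,
  (forall m, (m <= n)%N -> 1 <= gam m) /\
  forall k, (2 * k + 1)%N%:R ^+ n =
    \sum_(m < n.+1) gam m * (2 ^+ m * (k ^_ m)%:R).
Proof.
elim: n => [|n [gam [gam1 gamE]]].
  exists (fun=> 1); split=> // k.
  by rewrite big_ord1 expr0 ffactn0 expr0 !mulr1.
pose ext m := if (m <= n)%N then gam m else 0.
have ext0 m : 0 <= ext m.
  by rewrite /ext; case: leqP => // /gam1; apply: le_trans.
exists (fun m => (2 * m + 1)%N%:R * ext m + (if m is m'.+1 then ext m' else 0)).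
split=> [m mn|k].
  have [mn'|mn'] := leqP m n.
    apply: (@le_trans _ _ ((2 * m + 1)%N%:R * ext m)); last first.
      by rewrite lerDl; case: m {mn mn'}.
    rewrite -[leLHS]mul1r ler_pM// ?ler1n ?addn1//.
    by rewrite /ext mn' gam1.
  have -> : m = n.+1 by apply/eqP; rewrite eqn_leq mn.
  by rewrite /ext ltnn leqnn mulr0 add0r gam1.
rewrite exprS gamE mulr_sumr.
under [RHS]eq_bigr => m _ do rewrite mulrDl.
rewrite big_split/= [X in _ = X + _]big_ord_recr [X in _ =
  _ + X]big_ord_recl /=.
rewrite {2}/ext ltnn mulr0 !mul0r addr0 add0r -big_split/=.
apply: eq_bigr => m _; rewrite /bump leq0n add1n /ext -ltnS ltn_ord.
rewrite add0n ffactnSr; have [mk|km] := leqP m k; last first.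
  by rewrite ffact_small//; ring.
by rewrite natrM natrB// !natrD ?natrM exprS; ring.
Qed.

End ladder.

(** * Orders of operators and commutators *)

Section order.
Variable R : realType.
Local Notation Sch := (schwartz_space R).
Local Notation low m := (iter m (@lower R)).
Implicit Types (f g h : Sch) (s : sbd_fun R) (a b x t : R) (j k m n : nat).
Implicit Types (P Q : Sch -> Sch).
Local Notation mu := (@lebesgue_measure R).

Lemma inner_add_le f g : inner (f + g) (f + g) <= 2 * inner f f + 2 * inner g g.
Proof.
have := inner_ge0 (f - g); rewrite !innerDl !innerDr !innerNl !innerNr
  (innerC g f).
lra.
Qed.

Lemma inner_pair_le f g : 2 * inner f g <= inner f f + inner g g.
Proof.
have := inner_ge0 (f - g); rewrite !innerDl !innerDr !innerNl !innerNr
  (innerC g f).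
lra.
Qed.

Lemma le_inner2 f g h a b : (forall x, f x ^+ 2 <=
  a * g x ^+ 2 + b * h x ^+ 2) ->
  inner f f <= a * inner g g + b * inner h h.
Proof.
move=> H; rewrite /inner /L2_inner.
have iZ c (u : Sch) : mu.-integrable setT (EFin \o (fun x => c * (u x * u x))).
  exact: (@integrableZl _ _ R mu setT measurableT c _ (inner_integrable u u)).
rewrite -!RintegralZl//; try exact: inner_integrable.
rewrite -RintegralD//; try exact: iZ.
apply: le_Rintegral => //; first exact: inner_integrable.
  exact: (@integrableD _ _ R mu setT measurableT _ _ (iZ a g) (iZ b h)).
by move=> x _; have := H x; rewrite !expr2.
Qed.

(** This controls |x f| and |f'| by |lower f| and |f|. *)
Lemma lower_norm f : inner (lower f) (lower f) =
  inner (mulby (sbd_X R) f) (mulby (sbd_X R) f) + inner (ddx f) (ddx f)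
    - inner f f.
Proof.
have := ddx_mulby (sbd_X R) f; rewrite mulby_deriv_X => DX.
have : inner (mulby (sbd_X R) f) (ddx f) =
  - inner f f - inner f (mulby (sbd_X R) (ddx f)).
  by rewrite inner_ddxr DX innerDl opprD [inner (mulby _ _) f]innerC.
rewrite -inner_mulby => H.
rewrite /lower !innerDl !innerDr (innerC (ddx f)); lra.
Qed.

Lemma mulby_bound s : exists2 K : R, 0 <= K &
  forall f, inner (mulby s f) (mulby s f) <=
    K * (inner f f + inner (lower f) (lower f)).
Proof.
have [K K0 HK] := sbd_growth (sbd_valP s).
exists (4 * K ^+ 2); first by rewrite mulr_ge0// sqr_ge0.
move=> f; apply: (@le_trans _ _ (2 * K ^+ 2 * inner f f +
    2 * K ^+ 2 * inner (mulby (sbd_X R) f) (mulby (sbd_X R) f))).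
  apply: le_inner2 => x /=.
  have hs : s x ^+ 2 <= 2 * K ^+ 2 * (1 + x ^+ 2).
    rewrite -(real_normK (num_real (s x))) -(real_normK (num_real x)).
    apply: (@le_trans _ _ ((K * (1 + `|x|)) ^+ 2)).
      by rewrite lerXn2r ?nnegrE ?mulr_ge0 ?addr_ge0.
    by have := sqr_ge0 (K * (1 - `|x|)); nra.
  have := ler_wpM2r (sqr_ge0 (f x)) hs; rewrite !exprMn.
  set u := s x ^+ 2; set v := f x ^+ 2; set k2 := K ^+ 2; set y := x ^+ 2; nra.
have := lower_norm f; have := inner_ge0 (ddx f); have := inner_ge0 f;
  have := sqr_ge0 K.
have := inner_ge0 (lower f); set k2 := K ^+ 2; nra.
Qed.

Definition energy n f : R := \sum_(i < n) inner (low i f) (low i f).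

Lemma energy_ge0 n f : 0 <= energy n f.
Proof. by apply: sumr_ge0 => i _; exact: inner_ge0. Qed.

Lemma energy_le m n f : (m <= n)%N -> energy m f <= energy n f.
Proof.
move=> /subnK <-; elim: (n - m)%N => [//|k IH].
by rewrite addSn /energy big_ord_recr /= (le_trans IH)// lerDl inner_ge0.
Qed.

Lemma energy_term m n f : (m < n)%N ->
  inner (low m f) (low m f) <= energy n f.
Proof.
move=> /(energy_le f); apply: le_trans.
by rewrite /energy big_ord_recr /= lerDr; apply: sumr_ge0 => i _;
  exact: inner_ge0.
Qed.

(** The norm of [P f] is controlled by those of f, [lower f], ..., up to n-1
    terms, and stays so, with the expected shift, when [lower] is applied
    afterwards.  The offset by two (the identity has order 2) leaves room for
    double commutators to have order [m] even at [m = 0], where they vanish. *)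
Definition order n P := forall j, exists2 C : R, 0 <= C &
  forall f, inner (low j (P f)) (low j (P f)) <= C * energy (n + j).-1 f.

Lemma order_ext n P Q : P =1 Q -> order n P -> order n Q.
Proof.
move=> PQ oP j; have [C C0 HC] := oP j.
by exists C => // f; rewrite -PQ.
Qed.

Lemma iter_lowerD j f g : low j (f + g) = low j f + low j g.
Proof. by elim: j => [//|j IH]; rewrite !iterS IH lowerD. Qed.
Lemma iter_lowerZ j a f : low j (a *: f) = a *: low j f.
Proof. by elim: j => [//|j IH]; rewrite !iterS IH lowerZ. Qed.
Lemma iter_lowerN j f : low j (- f) = - low j f.
Proof. by elim: j => [//|j IH]; rewrite !iterS IH lowerN. Qed.

Lemma order_zero n : order n (fun=> 0).
Proof.
move=> j; exists 0 => // f.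
have -> : low j 0 = 0 by elim: j => [//|j IH]; rewrite iterS IH; exact: linear0.
by rewrite inner0l mul0r.
Qed.

Lemma orderD n P Q : order n P -> order n Q -> order n (fun f => P f + Q f).
Proof.
move=> oP oQ j; have [A A0 HA] := oP j; have [B B0 HB] := oQ j.
exists (2 * A + 2 * B); first by rewrite addr_ge0// mulr_ge0.
move=> f; rewrite iter_lowerD; apply: (le_trans (inner_add_le _ _)).
by rewrite [leRHS]mulrDl -!mulrA lerD// ler_wpM2l.
Qed.

Lemma orderZ n a P : order n P -> order n (fun f => a *: P f).
Proof.
move=> oP j; have [A A0 HA] := oP j.
exists (a ^+ 2 * A); first by rewrite mulr_ge0// sqr_ge0.
by move=> f; rewrite iter_lowerZ innerZl innerZr mulrA -expr2 -mulrA
  ler_wpM2l// sqr_ge0.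
Qed.

Lemma orderN n P : order n P -> order n (fun f => - P f).
Proof.
by move=> oP j; have [A A0 HA] := oP j; exists A => // f;
  rewrite iter_lowerN innerNl innerNr opprK.
Qed.

Lemma orderB n P Q : order n P -> order n Q -> order n (fun f => P f - Q f).
Proof. by move=> oP oQ; apply: orderD => //; apply: orderN. Qed.

Lemma order_lower n P : order n P -> order n.+1 (fun f => lower (P f)).
Proof.
move=> oP j; have [A A0 HA] := oP j.+1; exists A => // f.
by have := HA f; rewrite iterSr addnS addSn.
Qed.

Lemma order_iter_lower m : order m.+2 (low m).
Proof.
move=> j; exists 1 => // f; rewrite mul1r -iterD; apply: energy_term.
by rewrite addSn /= addnC.
Qed.

(** A multiplier of linear growth costs one order, like x itself: for the
    later iterates of [lower], use [lower s = s lower + s'] and induction. *)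
Lemma order_mulby n s P : order n P -> order n.+1 (fun f => mulby s (P f)).
Proof.
suff H j : forall n s P, order n P -> exists2 C : R, 0 <= C & forall f,
    inner (low j (mulby s (P f))) (low j (mulby s (P f)))
      <= C * energy (n.+1 + j).-1 f.
  by move=> oP j; exact: H.
elim: j => [|j IH] {}n {}s {}P oP.
  have [K K0 HK] := mulby_bound s.
  have [A A0 HA] := oP 0%N; have [B B0 HB] := oP 1%N.
  exists (K * (A + B)); first by rewrite mulr_ge0// addr_ge0.
  move=> f; apply: (le_trans (HK _));
    rewrite -mulrA ler_wpM2l// [leRHS]mulrDl addn0.
  apply: lerD; last by have := HB f; rewrite addn1.
  apply: (le_trans (HA f)); rewrite ler_wpM2l// energy_le// addn0.
  exact: leq_pred.
have [A A0 HA] := IH _ s _ (order_lower oP).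
have [B B0 HB] := IH _ (sbd_deriv s) _ oP.
exists (2 * A + 2 * B); first by rewrite addr_ge0// mulr_ge0.
move=> f; rewrite iterSr lower_mulby iter_lowerD;
  apply: (le_trans (inner_add_le _ _)).
rewrite [leRHS]mulrDl -!mulrA lerD// ler_wpM2l//.
  by have := HA f; rewrite addSn addnS.
apply: (le_trans (HB f)); rewrite ler_wpM2l// energy_le//.
by rewrite !addSn addnS.
Qed.

Definition bounded_sbd s := exists M : R, forall x, `|s x| <= M.

Lemma bounded_sbd_deriv s : bounded_sbd (sbd_deriv s).
Proof. exact: sbd_derive1_bounded (sbd_valP s). Qed.

(** All derivatives of a bounded multiplier being bounded too, no order is
    lost. *)
Lemma order_mulby_bounded n s P : bounded_sbd s -> order n P ->
  order n (fun f => mulby s (P f)).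
Proof.
suff H j : forall n s P, bounded_sbd s -> order n P -> exists2 C : R, 0 <=
  C & forall f,
    inner (low j (mulby s (P f))) (low j (mulby s (P f)))
      <= C * energy (n + j).-1 f.
  by move=> bs oP j; exact: H.
elim: j => [|j IH] {}n {}s {}P bs oP.
  have [M HM] := bs; have [A A0 HA] := oP 0%N.
  exists (M ^+ 2 * A); first by rewrite mulr_ge0// sqr_ge0.
  move=> f; apply: (@le_trans _ _ (M ^+ 2 * inner (P f) (P f)
    + 0 * inner (P f) (P f))).
    apply: le_inner2 => x /=; rewrite mul0r addr0 exprMn ler_wpM2r ?sqr_ge0//.
    rewrite -(real_normK (num_real (s x))) lerXn2r ?nnegrE//.
    exact: le_trans (HM x).
  by rewrite mul0r addr0 -mulrA ler_wpM2l ?sqr_ge0//; exact: HA.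
have [A A0 HA] := IH _ s _ bs (order_lower oP).
have [B B0 HB] := IH _ (sbd_deriv s) _ (bounded_sbd_deriv s) oP.
exists (2 * A + 2 * B); first by rewrite addr_ge0// mulr_ge0.
move=> f; rewrite iterSr lower_mulby iter_lowerD;
  apply: (le_trans (inner_add_le _ _)).
rewrite [leRHS]mulrDl -!mulrA lerD// ler_wpM2l//.
  by have := HA f; rewrite addSn addnS.
apply: (le_trans (HB f)); rewrite ler_wpM2l// energy_le//.
by rewrite addnS /= leq_pred.
Qed.

Lemma order_ddx n P : order n P -> order n.+1 (fun f => ddx (P f)).
Proof.
move=> oP; apply: (@order_ext _ (fun f => lower (P f) - mulby (sbd_X R) (P f))).
  by move=> f; rewrite /lower [mulby _ _ + _]addrC addrK.
by apply: orderB; [exact: order_lower|exact: order_mulby].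
Qed.

Lemma energy_mulby n s : exists2 C : R, 0 <= C &
  forall f, energy n (mulby s f) <= C * energy n.+1 f.
Proof.
elim: n => [|n [A A0 HA]].
  by exists 0 => // f; rewrite /energy big_ord0 mul0r.
have [B B0 HB] := order_mulby s (@order_iter_lower 0) n.
exists (A + B); first exact: addr_ge0.
move=> f; rewrite /energy big_ord_recr /= -/(energy n _) mulrDl; apply: lerD;
  last exact: HB.
by apply: (le_trans (HA f)); rewrite ler_wpM2l//; exact: energy_le.
Qed.

Lemma order_comp_mulby n s P : order n P -> order n.+1 (fun f => P (mulby s f)).
Proof.
move=> oP j; have [A A0 HA] := oP j.
have [B B0 HB] := energy_mulby (n + j).-1 s.
exists (A * B); first exact: mulr_ge0.
move=> f; apply: (le_trans (HA _)); rewrite -mulrA ler_wpM2l// addSn /=.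
case: (n + j)%N (HB f) => [_|i //].
by rewrite /= /energy big_ord0 mulr_ge0// energy_ge0.
Qed.

(** The commutators of [lower^m] with d/dx and with a multiplier, then the
    iterated ones.  For d/dx they have a closed form because
    [lower, d/dx] = -1. *)
Definition commD m f := m%:R *: low m.-1 f.
Definition commDD m f := m%:R *: commD m.-1 f.
Definition commM s m f := low m (mulby s f) - mulby s (low m f).
Definition commMM s m f := commM s m (mulby s f) - mulby s (commM s m f).
Definition commDM s m f := commD m (mulby s f) - mulby s (commD m f).

Lemma commDS m f : commD m.+1 f = low m f + lower (commD m f).
Proof.
rewrite /commD lowerZ; case: m => [|m] /=;
  first by rewrite scale0r addr0 scale1r.
by rewrite -[m.+2%:R]natr1 scalerDl scale1r addrC.
Qed.

Lemma iter_lower_ddx m f : low m (ddx f) = ddx (low m f) - commD m f.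
Proof.
elim: m => [|m IH]; first by rewrite /commD scale0r subr0.
by rewrite !iterS IH lowerD lowerN lower_ddx commDS [in RHS]opprD [RHS]addrA.
Qed.

Lemma commD_ddx m f : commD m (ddx f) = ddx (commD m f) - commDD m f.
Proof.
case: m => [|m]; first by rewrite /commDD /commD !scale0r ddx0 subrr.
by rewrite /commDD /commD /= iter_lower_ddx ddxZ scalerBr.
Qed.

Lemma iter_lower_ddx2 m f : low m (ddx (ddx f)) =
  ddx (ddx (low m f)) - 2 *: ddx (commD m f) + commDD m f.
Proof.
rewrite iter_lower_ddx iter_lower_ddx ddxD ddxN commD_ddx opprB scaler_nat
  mulr2n opprD.
by rewrite -!addrA; congr (_ + _); congr (_ + _); rewrite addrC.
Qed.

Lemma commMS s m f : commM s m.+1 f =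
  lower (commM s m f) + mulby (sbd_deriv s) (low m f).
Proof.
rewrite /commM !iterS lowerD lowerN lower_mulby opprD addrA.
by rewrite -[RHS]addrA addNr addr0.
Qed.

Lemma commMMS s m f : commMM s m.+1 f =
  lower (commMM s m f) + 2 *: mulby (sbd_deriv s) (commM s m f).
Proof.
rewrite /commMM !commMS lowerD lowerN lower_mulby mulbyD
  [mulby s (mulby (sbd_deriv s) _)]mulbyC.
rewrite {3}/commM.
have E (a b c d e g' : Sch) : e = b - d ->
    a + b - (c + d) = a - (c + g') + (g' + e).
  by move=> ->; rewrite !opprD !addrA subrK [a + b - c]addrAC.
rewrite scaler_nat mulr2n; apply: E.
by rewrite mulbyD mulbyN.
Qed.

Lemma order_commD m : order m.+1 (commD m).
Proof.
case: m => [|m]; last by apply: orderZ; exact: order_iter_lower.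
by apply: order_ext (order_zero _) => f; rewrite /commD scale0r.
Qed.

Lemma order_commDD m : order m (commDD m).
Proof.
case: m => [|m]; last by apply: orderZ; exact: order_commD.
by apply: order_ext (order_zero _) => f; rewrite /commDD scale0r.
Qed.

(** The recursion [commMS] only involves the bounded multiplier s', so
    the commutator has one order less than [lower^m] even when s is
    unbounded. *)
Lemma order_commM s m : order m.+1 (commM s m).
Proof.
elim: m => [|m IH]; first by apply: order_ext (order_zero _) => f;
  rewrite /commM subrr.
apply: order_ext (fun f => esym (commMS s m f)) _; apply: orderD;
  first exact: order_lower.
by apply: order_mulby_bounded; [exact: bounded_sbd_deriv|exact:
  order_iter_lower].
Qed.

Lemma order_commMM s m : order m (commMM s m).
Proof.
elim: m => [|m IH].
  by apply: order_ext (order_zero _) => f;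
    rewrite /commMM /commM !subrr mulby0 subrr.
apply: order_ext (fun f => esym (commMMS s m f)) _; apply: orderD;
  first exact: order_lower.
apply: orderZ; apply: order_mulby_bounded; first exact: bounded_sbd_deriv.
exact: order_commM.
Qed.

Lemma order_commDM s m : order m (commDM s m).
Proof.
case: m => [|m].
  by apply: order_ext (order_zero _) => f;
    rewrite /commDM /commD !scale0r mulby0 subrr.
apply: (@order_ext _ (fun f => m.+1%:R *: commM s m f)); last by apply: orderZ;
  exact: order_commM.
by move=> f; rewrite /commDM /commD /commM mulbyZ scalerBr.
Qed.

(** The cancellation at the heart of the estimate.  Here u stands for
    [lower^m phi], the vectors v and k for the simple and double commutators of
    [lower^m] with s, and y, z, r for the contributions of the commutator with
    d/dx.  On the right no derivative falls on u, and s itself, as opposed to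
    its derivative, no longer appears. *)
Lemma second_order_identity s (u v k y z r : Sch) :
  inner u (ddx (ddx (mulby s (mulby s u + v) + (mulby s v + k)))
    - 2 *: ddx (mulby s y + z) + r)
    + inner (ddx (mulby s u + v) - y) (ddx (mulby s u + v) - y)
  = inner (mulby (sbd_deriv s) u) (mulby (sbd_deriv s) u)
    + inner u (2 *: ddx (mulby (sbd_deriv s) v)
      + 2 *: mulby (sbd_deriv s) (ddx v) + ddx (ddx k)
            - 2 *: mulby (sbd_deriv s) y - 2 *: ddx z + r)
    + inner (ddx v - y) (ddx v - y).
Proof.
set s' := sbd_deriv s; set a := mulby s' u; set c := mulby s (ddx u).
have Dsu : ddx (mulby s u) = a + c by exact: ddx_mulby.
have F w : inner u (ddx (ddx (mulby s w))) =
  - inner (ddx u) (mulby s' w) - inner c (ddx w).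
  by rewrite inner_ddxr ddx_mulby innerDr opprD inner_mulby.
have Fa : inner (ddx u) (mulby s' (mulby s u)) =
  inner c a by rewrite mulbyC -inner_mulby.
have Fy : inner u (ddx (mulby s y)) =
  - inner c y by rewrite inner_ddxr -inner_mulby.
have Fv : inner u (ddx (mulby s' v)) =
  - inner (ddx u) (mulby s' v) by rewrite inner_ddxr.
have split_lhs (T1 T2 B k' z' r' : Sch) :
    inner u (ddx (ddx (T1 + (T2 + k'))) - 2 *: ddx (B + z') + r') =
    inner u (ddx (ddx T1)) + inner u (ddx (ddx T2)) + inner u (ddx (ddx k'))
      - 2 * (inner u (ddx B) + inner u (ddx z')) + inner u r'.
  rewrite !ddxD; move: (ddx (ddx T1)) (ddx (ddx T2)) (ddx (ddx k')) (ddx B)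
    (ddx z') => x1 x2 x3 x4 x5.
  by rewrite !innerDr innerNr innerZr innerDr !addrA.
have split_rhs (A B C E G r' : Sch) :
    inner u (2 *: A + 2 *: B + C - 2 *: E - 2 *: G + r') =
    2 * inner u A + 2 * inner u B + inner u C - 2 * inner u E - 2 * inner u G
      + inner u r'.
  by rewrite !innerDr !innerNr !innerZr.
have F1 : inner u (ddx (ddx (mulby s (mulby s u + v)))) =
    - inner c a - inner (ddx u) (mulby s' v) - inner c (a + c + ddx v).
  by rewrite F ddxD Dsu [mulby s' _]mulbyD innerDr Fa opprD.
have Fa' : inner u (mulby s' (ddx v)) = inner a (ddx v) by rewrite -inner_mulby.
have Fy' : inner u (mulby s' y) = inner a y by rewrite -inner_mulby.
rewrite split_lhs split_rhs F1 F Fy Fv Fa' Fy' ddxD Dsu.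
clear Dsu F Fa Fy Fv F1 Fa' Fy' split_lhs split_rhs.
move: (inner (ddx u) _) (inner u (ddx (ddx k))) (inner u (ddx z)) (inner u r) =>
  e1 e2 e3 e4.
move: a c (ddx v) => a c w.
rewrite !(innerDr, innerDl, innerNl,
  innerNr) (innerC c a) (innerC w a) (innerC w c) (innerC y a) (innerC y c).
rewrite (innerC y w); ring.
Qed.
End order.

(** * The monotonicity inequality *)

Section estimate.
Variable R : realType.
Local Notation Sch := (schwartz_space R).
Local Notation low m := (iter m (@lower R)).
Implicit Types (f g h : Sch) (s b : sbd_fun R) (x t : R) (j k m n : nat).

Definition Aschwartz s f : Sch := - ddx (mulby s f).
Definition Lschwartz s b f : Sch :=
  2^-1 *: ddx (ddx (mulby s (mulby s f))) - ddx (mulby b f).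

Lemma AschwartzE s f : Aschwartz s f = Astar s f :> (R -> R).
Proof. by []. Qed.

Lemma LschwartzE s b f : Lschwartz s b f = Lstar s b f :> (R -> R).
Proof.
apply/funext => x; rewrite /Lstar.
have -> : (fun y => s y ^+ 2 * f y) = (fun y => s y * (s y * f y)).
  by apply/funext => y; rewrite mulrA.
by [].
Qed.

(** Antisymmetry of b d/dx up to b'. *)
Lemma first_order_identity b (u : Sch) :
  2 * inner u (ddx (mulby b u)) = inner u (mulby (sbd_deriv b) u).
Proof.
have H1 : inner u (ddx (mulby b u)) =
  inner u (mulby (sbd_deriv b) u) + inner u (mulby b (ddx u)).
  by rewrite ddx_mulby innerDr.
have H2 : inner u (ddx (mulby b u)) = - inner u (mulby b (ddx u)).
  by rewrite inner_ddxr -inner_mulby innerC [inner u _]innerC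
    inner_mulby innerC.
by rewrite mulr_natl mulr2n {1}H1 H2 addrK.
Qed.

Definition second_order_rest s b m f : Sch :=
  2 *: ddx (mulby (sbd_deriv s) (commM s m f))
    + 2 *: mulby (sbd_deriv s) (ddx (commM s m f))
  + ddx (ddx (commMM s m f)) - 2 *: mulby (sbd_deriv s) (commD m (mulby s f))
  - 2 *: ddx (commDM s m (mulby s f)) + commDD m (mulby s (mulby s f)).

Definition first_order_rest b m f : Sch :=
  mulby (sbd_deriv b) (low m f) + 2 *: ddx (commM b m f)
    - 2 *: commD m (mulby b f).

Lemma order_second_order_rest s b m : order m.+2 (second_order_rest s b m).
Proof.
have bs := bounded_sbd_deriv s.
apply: orderD; last first.
  apply: (@order_comp_mulby _ m.+1 s (fun f => commDD m (mulby s f))).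
  by apply: (@order_comp_mulby _ m s (commDD m)); exact: order_commDD.
apply: orderB; last by apply: orderZ; apply: order_ddx;
  apply: (@order_comp_mulby _ m s (commDM s m)); exact: order_commDM.
apply: orderB; last first.
  by apply: orderZ; apply: order_mulby_bounded => //;
    apply: (@order_comp_mulby _ m.+1 s (commD m)); exact: order_commD.
apply: orderD; last by do 2 apply: order_ddx; exact: order_commMM.
by apply: orderD; apply: orderZ; [apply: order_ddx; apply: order_mulby_bounded|
  apply: order_mulby_bounded => //; apply: order_ddx]; rewrite //;
    exact: order_commM.
Qed.

Lemma order_first_order_rest b m : order m.+2 (first_order_rest b m).
Proof.
apply: orderB; last by apply: orderZ;
  apply: (@order_comp_mulby _ m.+1 b (commD m)); exact: order_commD.
apply: orderD; last by apply: orderZ; apply: order_ddx; exact: order_commM.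
by apply: order_mulby_bounded; [exact: bounded_sbd_deriv|exact:
  order_iter_lower].
Qed.

Lemma iter_lower_mulby s m f :
  low m (mulby s f) = mulby s (low m f) + commM s m f.
Proof. by rewrite /commM addrC subrK. Qed.

(** The commutation relations bring [lower^m L* f] and [lower^m A* f] into the
    shape required by the two identities for u = [lower^m f]. *)
Lemma energy_identity s b m f : let u := low m f in
  2 * inner u (low m (Lschwartz s b f))
    + inner (low m (Aschwartz s f)) (low m (Aschwartz s f)) =
  inner (mulby (sbd_deriv s) u) (mulby (sbd_deriv s) u)
    + inner u (second_order_rest s b m f)
    + inner (ddx (commM s m f) - commD m (mulby s f))
        (ddx (commM s m f) - commD m (mulby s f))
    - inner u (first_order_rest b m f).
Proof.
move=> u.
have ET : low m (mulby s (mulby s f)) =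
    mulby s (mulby s u + commM s m f) + (mulby s (commM s m f) + commMM s m f).
  by rewrite iter_lower_mulby iter_lower_mulby /commMM
    [mulby s (commM s m f) + _]addrC subrK.
have EQ : commD m (mulby s (mulby s f)) =
  mulby s (commD m (mulby s f)) + commDM s m (mulby s f).
  by rewrite /commDM addrC subrK.
have EA : low m (Aschwartz s f) =
  - (ddx (mulby s u + commM s m f) - commD m (mulby s f)).
  by rewrite /Aschwartz iter_lowerN iter_lower_ddx iter_lower_mulby.
have EL : low m (Lschwartz s b f) =
    2^-1 *: (ddx (ddx (low m (mulby s (mulby s f))))
       - 2 *: ddx (commD m (mulby s (mulby s f)))
         + commDD m (mulby s (mulby s f)))
    - (ddx (mulby b u + commM b m f) - commD m (mulby b f)).
  by rewrite /Lschwartz iter_lowerD iter_lowerN iter_lowerZ iter_lower_ddx2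
    iter_lower_ddx (iter_lower_mulby b).
have := second_order_identity s u (commM s m f) (commMM s m f)
  (commD m (mulby s f))
  (commDM s m (mulby s f)) (commDD m (mulby s (mulby s f))).
rewrite -ET -EQ -/(second_order_rest s b m f) EA EL.
have EB : 2 * inner u (ddx (mulby b u + commM b m f) - commD m (mulby b f)) =
  inner u (first_order_rest b m f).
  rewrite ddxD /first_order_rest -/u.
  have := first_order_identity b u.
  move: (ddx (mulby b u)) (ddx (commM b m f)) (commD m (mulby b f)) (mulby _ u)
    => x1 x2 x3 x4.
  by rewrite !innerDr !innerNr !innerZr => <-; ring.
rewrite -EB.
move: (ddx (mulby s u + commM s m f) - _) (_ + commDD m _)
  (ddx (mulby b u + commM b m f) - _).
move=> X Y W; rewrite innerNl innerNr opprK [inner u (_ - W)]innerDr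
  [inner u (- W)]innerNr [inner u (_ *: Y)]innerZr => H.
rewrite mulrBr mulrA divff ?pnatr_eq0// mul1r addrAC H.
by [].
Qed.

Lemma estimate s b m : exists2 C : R, 0 <= C & forall f,
  2 * inner (low m f) (low m (Lschwartz s b f))
    + inner (low m (Aschwartz s f)) (low m (Aschwartz s f))
  <= C * energy m.+1 f.
Proof.
have [A A0 HA] := order_mulby_bounded (bounded_sbd_deriv s)
  (@order_iter_lower R m) 0%N.
have [B B0 HB] := order_second_order_rest s b m 0%N.
have oC : order m.+2 (fun f => ddx (commM s m f) - commD m (mulby s f)).
  apply: orderB; first by apply: order_ddx; exact: order_commM.
  by apply: (@order_comp_mulby _ m.+1 s (commD m)); exact: order_commD.
have [C C0 HC] := oC 0%N.
have [E E0 HE] := order_first_order_rest b m 0%N.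
exists (A + B + C + E + 1); first by rewrite !addr_ge0.
move=> f; rewrite energy_identity.
have := HA f; have := HB f; have := HC f; have := HE f; rewrite addn0 /=.
have := inner_pair_le (low m f) (second_order_rest s b m f).
have := inner_pair_le (low m f) (- first_order_rest b m f);
  rewrite innerNr innerNl innerNr opprK.
have := energy_term f (ltnSn m).
have := inner_ge0 (second_order_rest s b m f);
  have := inner_ge0 (first_order_rest b m f).
move: (energy m.+1 f) (inner (iter m _ f) (iter m _ f)) => N u.
move: (inner (second_order_rest s b m f) _) (inner (first_order_rest b m f) _)
  => r r1.
move: (inner _ (second_order_rest s b m f)) (inner _ (first_order_rest b m f))
  => p p1.
move: (inner (mulby _ _) _) (inner (ddx _ - _) _) => q1 q2.
by move=> *; rewrite !mulrDl; lra.
Qed.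

Lemma HS_innerE p : exists gam : nat -> R,
  (forall m, (m <= 2 * p)%N -> 1 <= gam m) /\
  forall f g, HS_inner p%:R f g =
    \sum_(m < (2 * p).+1) gam m * inner (low m f) (low m g).
Proof.
have [gam [gam1 gamE]] := odd_power_ffact R (2 * p).
exists gam; split=> // f g; apply: cvg_lim; first exact: Rhausdorff.
have hfunE k : hermite_fun k = herm R k by apply/funext => x; rewrite hermE.
rewrite (_ : series _ = (fun n => \sum_(m < (2 * p).+1) gam m *
    \sum_(k < n) 2 ^+ m * (k ^_ m)%:R * (hcoef k f * hcoef k g))).
  apply: cvg_big => [|m _]; first exact: add_continuous.
  by apply: cvgMr; exact: parseval_lower.
apply/funext => n; rewrite /series /= big_mkord.
under [RHS]eq_bigr => m _ do rewrite mulr_sumr.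
rewrite exchange_big /=; apply: eq_bigr => k _.
rewrite -natrM powR_mulrn// gamE hfunE !mulr_suml; apply: eq_bigr => m _.
by rewrite /hcoef /inner; ring.
Qed.

End estimate.

Unset Implicit Arguments.

Theorem theorem1p6 (R : realType) (sigma b : R -> R)
    (hsigma : smooth_bounded_derivatives sigma)
    (hb : smooth_bounded_derivatives b) (p : nat) :
  exists C : R, 0 < C /\
    forall phi : R -> R, schwartz phi ->
      2%:R * HS_inner p%:R phi (Lstar sigma b phi)
        + HS_norm p%:R (Astar sigma phi) ^+ 2
      <= C * HS_norm p%:R phi ^+ 2.
Proof.
pose s := SbdFun hsigma; pose bb := SbdFun hb.
have [gam [gam1 HSE]] := HS_innerE R p.
have gam0 m : (m < (2 * p).+1)%N -> 0 <= gam m.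
  by move=> mp; apply: le_trans (gam1 m mp).
have /choice[C HC] : forall m, exists C : R,
  0 <= C /\ forall f : schwartz_space R,
    2 * inner (iter m (@lower R) f) (iter m (@lower R) (Lschwartz s bb f))
      + inner (iter m (@lower R) (Aschwartz s f))
        (iter m (@lower R) (Aschwartz s f))
    <= C * energy m.+1 f.
  by move=> m; have [C C0 HC] := estimate s bb m; exists C.
pose K := \sum_(m < (2 * p).+1) gam m * C m.
have K0 : 0 <= K.
  by apply: sumr_ge0 => m _; rewrite mulr_ge0 ?gam0//; case: (HC m).
have HSge0 (f : schwartz_space R) : 0 <= HS_inner p%:R f f.
  by rewrite HSE; apply: sumr_ge0 => m _; rewrite mulr_ge0 ?gam0// inner_ge0.
have norm2 (f : schwartz_space R) : HS_norm p%:R f ^+ 2 = HS_inner p%:R f f.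
  by rewrite sqr_sqrtr.
exists (K + 1); split; first by rewrite ltr_wpDl.
move=> phi hphi; pose f := mk_schwartz hphi.
rewrite -[phi]/(schwartz_val f) -[sigma]/(sbd_val s) -[b]/(sbd_val bb).
rewrite -LschwartzE -AschwartzE !norm2.
have energyHS : energy (2 * p).+1 f <= HS_inner p%:R f f.
  rewrite HSE; apply: ler_sum => m _.
  by rewrite -[leLHS]mul1r ler_wpM2r ?inner_ge0// gam1// -ltnS.
apply: (@le_trans _ _ (K * energy (2 * p).+1 f)); last first.
  apply: ler_pM => //; first exact: energy_ge0.
  by rewrite lerDl.
rewrite !HSE mulr_sumr -big_split/= /K mulr_suml; apply: ler_sum => m _.
rewrite mulrCA -mulrDr -mulrA ler_wpM2l ?gam0//.
have [Cm0 Hm] := HC m; apply: (le_trans (Hm f)).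
by rewrite ler_wpM2l// energy_le.
Qed.
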